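(* For $n\ge1$ there is a bijection $\phi$ between the set of permutations $\sigma$ of $[n]$ and the set of increasing trees $T$ on $\{0,1,\dots,n\}$ such that the number of up-down runs of $\sigma$ equals the number of nonroot vertices of $\phi(\sigma)$ of even degree.
   Context: An increasing tree on $\{0,1,\dots,n\}$ is a rooted tree with vertex set $\{0,1,\dots,n\}$, root $0$, in which every child is larger than its parent (children unordered). The degree of a vertex is its number of children (so leaves have even degree $0$). For a permutation $\sigma$ of $[n]$, prepend $\sigma_0=0$; an up-down run is a maximal increasing or decreasing segment of consecutive entries of $\sigma_0\sigma_1\cdots\sigma_n$ (e.g. $2\,1$ has two up-down runs $0\,2$ and $2\,1$). *)

(* Defs.v *)
From mathcomp Require Import all_boot all_fingroup.

Set Implicit Arguments.
Unset Strict Implicit.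
Unset Printing Implicit Defensive.

Section RootedTrees.
Variables (V : finType) (root : V).

(* A rooted tree is given by its edges oriented away from the root:           *)
(* (u, v) \in E means that v is a child of u.  As E is a set of pairs, the    *)
(* children of a vertex are unordered.                                        *)
Implicit Type E : {set V * V}.

Definition child E : rel V := fun u v => (u, v) \in E.

Definition children E (u : V) : {set V} := [set v | child E u v].

Definition parents E (v : V) : {set V} := [set u | child E u v].

Definition rooted_tree E : bool :=
  [&& parents E root == set0,
      [forall (v | v != root), #|parents E v| == 1]
    & [forall v, connect (child E) root v]].

Definition degree E (u : V) : nat := #|children E u|.

Definition even_nonroot E : {set V} :=
  [set v | (v != root) && ~~ odd (degree E v)].

End RootedTrees.

Definition is_increasing_tree (n : nat) (E : {set 'I_n.+1 * 'I_n.+1}) : bool :=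
  rooted_tree ord0 E && [forall u, forall v, child E u v ==> (u < v)].

Definition increasing_tree (n : nat) : Type :=
  {E : {set 'I_n.+1 * 'I_n.+1} | is_increasing_tree E}.

(* s : {perm 'I_n} permutes {0, ..., n-1}, hence the shift of values by one;  *)
(* the word is s_0 s_1 ... s_n with s_0 = 0 and s_(i+1) = s(i) + 1.           *)
Definition perm_word (n : nat) (s : {perm 'I_n}) : seq nat :=
  0 :: [seq (s i).+1 | i <- enum 'I_n].

(* The entries of w at the positions i, ..., j, both ends included.           *)
Definition segment (w : seq nat) (i j : nat) : seq nat := drop i (take j.+1 w).

Definition monotone_segment (w : seq nat) (i j : nat) : bool :=
  (i <= j) && (sorted ltn (segment w i j) || sorted gtn (segment w i j)).

(* A run is identified with the pair of its end positions.  One-entry         *)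
(* segments count as monotone, but they are never maximal when n >= 1.        *)
Definition up_down_runs (n : nat) (s : {perm 'I_n}) :
    {set 'I_n.+1 * 'I_n.+1} :=
  [set p : 'I_n.+1 * 'I_n.+1 | monotone_segment (perm_word s) p.1 p.2 &&
    [forall q : 'I_n.+1 * 'I_n.+1,
      [&& q.1 <= p.1, p.2 <= q.2 & monotone_segment (perm_word s) q.1 q.2]
        ==> (q == p)]].

(* Main.v *)
(* Permutations and increasing trees grow in the same way.  Inserting n+1 into *)
(* a word of length n with k runs gives k words with k runs, one with k+1 and  *)
(* n-k with k+2.  Attaching the vertex n+1 to a tree on {0, ..., n} with k     *)
(* even nonroot vertices gives k trees with k even nonroot vertices (attach to *)
(* an even nonroot vertex), one with k+1 (attach to the root) and n-k with k+2 *)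
(* (attach to an odd nonroot vertex).  So the two statistics are               *)
(* equidistributed, which yields the bijection.                                *)

Require Import Defs.
From mathcomp Require Import all_boot all_fingroup.
From mathcomp Require Import zify.

Set Implicit Arguments.
Unset Strict Implicit.
Unset Printing Implicit Defensive.

(** It suffices that both statistics take each value equally often: sorting the two sets by
    statistic and matching equal ranks gives the bijection ([perm_eq_bijection]). Equidistribution
    goes by induction on n, as both multisets of values evolve by the same rule [growth]; multisets
    are compared through [count a] for every predicate [a].

    For words, runs are direction changes ([card_up_down_runs]). Placing n+1 on either side of an
    interior peak keeps the number of runs, as does appending it after a final ascent; appending it
    after a final descent, or placing it just before the end of a final ascent, adds one; every
    other slot adds two. [count_insertion_turns] derives these multiplicities by recursion along the
    word.

    An increasing tree is its word of parents ([increasing_treeP]), in which degrees are letter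
    multiplicities. Appending the letter j adds an even leaf and flips the parity of j
    ([count_even_letters_rcons]). *)

(** * From equal distributions to a bijection *)

Lemma index_surj (T : eqType) (s : seq T) (k : nat) :
  uniq s -> k < size s -> exists x, index x s = k.
Proof.
by case: s => // x0 s us lt_k; exists (nth x0 (x0 :: s) k); rewrite index_uniq.
Qed.

Lemma perm_eq_bijection (A B : finType) (f : A -> nat) (g : B -> nat) :
  perm_eq [seq f a | a <- enum A] [seq g b | b <- enum B] ->
  exists phi : A -> B, bijective phi /\ forall a, f a = g (phi a).
Proof.
move=> fg.
pose eA := sort (relpre f leq) (enum A); pose eB := sort (relpre g leq) (enum B).
have fgE : map f eA = map g eB.
  rewrite -!sort_map; apply/perm_sortP => //.
  - exact: leq_total.
  - exact: leq_trans.
  - exact: anti_leq.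
have sAB : size eA = size eB by rewrite -(size_map f) fgE size_map.
have inA a : a \in eA by rewrite mem_sort mem_enum.
have inB b : b \in eB by rewrite mem_sort mem_enum.
have uA : uniq eA by rewrite sort_uniq enum_uniq.
have uB : uniq eB by rewrite sort_uniq enum_uniq.
have phiP a : exists b, index b eB == index a eA.
  have [|b E] := index_surj (k := index a eA) uB; first by rewrite -sAB index_mem.
  by exists b; rewrite E.
have psiP b : exists a, index a eA == index b eB.
  have [|a E] := index_surj (k := index b eB) uA; first by rewrite sAB index_mem.
  by exists a; rewrite E.
pose phi a := xchoose (phiP a); pose psi b := xchoose (psiP b).
have phiE a : index (phi a) eB = index a eA by apply/eqP; exact: (xchooseP (phiP a)).
have psiE b : index (psi b) eA = index b eB by apply/eqP; exact: (xchooseP (psiP b)).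
exists phi; split.
  exists psi => [a | b].
    by apply: (index_inj a (s := eA)) => //; rewrite psiE phiE.
  by apply: (index_inj b (s := eB)) => //; rewrite phiE psiE.
move=> a; rewrite -{1}(nth_index a (inA a)) -(nth_index (phi a) (inB (phi a))).
have lt_a : index a eA < size eA by rewrite index_mem.
by rewrite -(nth_map _ 0) // fgE phiE (nth_map (phi a)) // -sAB.
Qed.

(** * Inserting the maximum into a word *)

(* Direction changes along [x :: t] when [x] is reached by an ascent ([b]) or  *)
(* a descent ([~~ b]).  In [turns false 0 t] the leading ascent is a change as *)
(* well, so that changes correspond to runs.                                   *)
Fixpoint turns (b : bool) (x : nat) (t : seq nat) : nat :=
  if t is y :: t' then (b != (x < y)) + turns (x < y) y t' else 0.

Definition insert (M : nat) (t : seq nat) (j : nat) : seq nat :=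
  take j t ++ M :: drop j t.

Definition insertion_turns (b : bool) (x M : nat) (t : seq nat) : seq nat :=
  [seq turns b x (insert M t j) | j <- iota 0 (size t).+1].

Lemma insertion_turns_cons b x M y t :
  insertion_turns b x M (y :: t) =
  turns b x [:: M, y & t] ::
    [seq (b != (x < y)) + k | k <- insertion_turns (x < y) y M t].
Proof.
have ioE : iota 0 (size t).+2 = 0 :: map (addn 1) (iota 0 (size t).+1).
  by rewrite -iotaDl.
by rewrite /insertion_turns [size _]/= ioE map_cons -!map_comp.
Qed.

Lemma turns_size b x t : turns b x t <= size t.
Proof. by elim: t b x => //= y t IHt b x; have := IHt (x < y) y; lia. Qed.

(* The number of values satisfying [a] among the statistics of the n+1         *)
(* extensions of an object of size [n] with statistic [k].                     *)
Definition growth (n k : nat) (a : pred nat) : nat :=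
  k * a k + a k.+1 + (n - k) * a k.+2.

(* The case of an ascent before [x] is completed by one extra item: the value *)
(* obtained by inserting [M] just before [x], in the middle of that ascent.   *)
Lemma count_insertion_turns_rec M t x (a : pred nat) :
  all (gtn M) (x :: t) ->
  count a (insertion_turns false x M t) = growth (size t) (turns false x t) a
  /\
  count a ((turns false x t).+1 :: insertion_turns true x M t) =
  growth (size t) (turns true x t) a + a (turns true x t).
Proof.
elim: t x a => [|y t IHt] x a.
  rewrite /insertion_turns /= /growth => /andP[-> _] /=; rewrite !addn0 /=; lia.
rewrite [all _ _]/= => /and3P[xM yM tM].
have /IHt IH : all (gtn M) (y :: t) by rewrite /= yM.
(* These bounds make the truncated subtraction in [growth] exact. *)
have leF := turns_size false y t; have leT := turns_size true y t.
rewrite !insertion_turns_cons; pose I b := insertion_turns b y M t.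
rewrite -/(I (x < y)); rewrite -/(I true) -/(I false) in IH.
move: I IH => I IH; rewrite /= xM ltnNge (ltnW yM) /= !count_map.
have preim0 : preim [eta addn 0] a =1 a by [].
(* Inserting [M] before [y] gives [2 + turns false y t]. If x < y this is the extra item of the
   induction hypothesis for [true], shifted by one; otherwise it is the one value with two more
   turns that the hypothesis for [false] lacks. *)
case: (ltnP x y) => _ /=; rewrite ?add0n ?add1n (eq_count preim0).
  have [_ /=] := IH (preim [eta addn 1] a); have [_ /=] := IH a.
  by rewrite /growth /= !add1n subSS subSn //; lia.
have [+ _] := IH (preim [eta addn 1] a); have [+ _] := IH a.
by rewrite /growth /= !add1n subSS subSn //; lia.
Qed.

Lemma iota_recr m n : iota m n.+1 = iota m n ++ [:: m + n].
Proof. by rewrite -addn1 iotaD. Qed.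

Lemma count_insertion_turns n t (a : pred nat) :
  perm_eq t (iota 1 n) ->
  count a [seq turns false 0 (insert n.+1 t j) | j <- iota 0 n.+1] =
  growth n (turns false 0 t) a.
Proof.
move=> t_iota.
have sz : size t = n by rewrite (perm_size t_iota) size_iota.
have bnd : all (gtn n.+1) (0 :: t).
  apply/allP=> x; rewrite inE => /orP[/eqP -> // |].
  by rewrite (perm_mem t_iota) mem_iota add1n => /andP[_].
by have [+ _] := count_insertion_turns_rec a bnd; rewrite /insertion_turns sz.
Qed.

Lemma perm_insert M t j : perm_eq (insert M t j) (M :: t).
Proof. by rewrite /insert perm_catC cat_cons perm_cons perm_catC cat_take_drop. Qed.

(** The position of n+1 and the word left after removing it recover both arguments of [insert], so
    there are no repetitions; (n+1) * n! = (n+1)! then gives exhaustion. *)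
Lemma permutations_insert n :
  perm_eq (permutations (iota 1 n.+1))
    [seq insert n.+1 t j | t <- permutations (iota 1 n), j <- iota 0 n.+1].
Proof.
have notin t : t \in permutations (iota 1 n) -> n.+1 \notin t.
  by rewrite mem_permutations => /perm_mem ->; rewrite mem_iota; lia.
have size_t t : t \in permutations (iota 1 n) -> size t = n.
  by rewrite mem_permutations => /perm_size ->; rewrite size_iota.
set L := [seq _ | _ <- _, _ <- _].
have uL : uniq L.
  apply: allpairs_uniq; rewrite ?permutations_uniq ?iota_uniq //.
  move=> x y /allpairsP[[t j] [tP jP ->]] /allpairsP[[u i] [uP iP ->]] /= eq_ins.
  rewrite /= in tP jP uP iP.
  have idx v k : v \in permutations (iota 1 n) -> k \in iota 0 n.+1 ->
      index n.+1 (insert n.+1 v k) = k /\ rem n.+1 (insert n.+1 v k) = v.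
    move=> vP kP; have Mv := notin v vP.
    have Mtake : n.+1 \notin take k v by apply: contra Mv; apply: mem_take.
    rewrite /insert index_cat (negPf Mtake) /= eqxx addn0 size_takel.
      split=> //; rewrite remE index_cat (negPf Mtake) /= eqxx addn0.
      by rewrite take_size_cat // drop_cat ltnNge leqnSn /= subSnn /= drop0 cat_take_drop.
    by rewrite size_t //; move: kP; rewrite mem_iota.
  have [ti tu] := idx _ _ tP jP; have [ui uu] := idx _ _ uP iP.
  by congr pair; [rewrite -[LHS]tu eq_ins | rewrite -[LHS]ti eq_ins].
have subL : {subset L <= permutations (iota 1 n.+1)}.
  move=> _ /allpairsP[[t j] [tP _ ->]]; rewrite mem_permutations.
  apply: perm_trans (perm_insert _ _ _) _.
  rewrite iota_recr add1n perm_sym perm_catC perm_cons perm_sym.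
  by rewrite -mem_permutations.
rewrite perm_sym; apply: uniq_perm => //; first exact: permutations_uniq.
apply: (uniq_min_size uL subL _).2.
by rewrite size_allpairs !size_permutations ?iota_uniq // !size_iota factS mulnC.
Qed.

Lemma count_flatten_map (T U : Type) (F : T -> seq U) (s : seq T) (a : pred U) :
  count a (flatten [seq F x | x <- s]) = \sum_(x <- s) count a (F x).
Proof. by rewrite count_flatten sumnE !big_map. Qed.

Lemma count_turns_permutations n (a : pred nat) :
  count a [seq turns false 0 t | t <- permutations (iota 1 n.+1)] =
  \sum_(k <- [seq turns false 0 t | t <- permutations (iota 1 n)]) growth n k a.
Proof.
rewrite (seq.permP (seq.perm_map _ (permutations_insert n))) map_flatten -map_comp.
rewrite count_flatten_map big_map; apply: eq_big_seq => t.
by rewrite mem_permutations => /count_insertion_turns <-; rewrite /= -map_comp.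
Qed.

(** * Attaching a new maximal vertex to a tree *)

(** The letter at index i is the parent of vertex i+1, so it is at most i. *)
Fixpoint parent_words (n : nat) : seq (seq nat) :=
  if n is m.+1 then [seq rcons p j | p <- parent_words m, j <- iota 0 m.+1]
  else [:: [::]].

Lemma parent_words_recr n :
  parent_words n.+1 = [seq rcons p j | p <- parent_words n, j <- iota 0 n.+1].
Proof. by []. Qed.

Lemma parent_wordsP n p :
  reflect (size p = n /\ forall i, i < n -> nth 0 p i <= i) (p \in parent_words n).
Proof.
elim: n p => [|n IHn] p.
  by apply: (iffP idP) => [|[/size0nil -> _]] //; rewrite inE => /eqP->.
apply: (iffP allpairsP) => [[[q j] [/IHn[sz_q le_q] j_n ->]] | [sz_p le_p]].
  rewrite mem_iota /= in j_n.
  split=> [|i]; first by rewrite size_rcons sz_q.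
  rewrite ltnS leq_eqVlt nth_rcons sz_q => /orP[/eqP -> | lt_i].
    by rewrite ltnn eqxx.
  by rewrite lt_i le_q.
case/lastP: p sz_p le_p => // q j; rewrite size_rcons => -[sz_q] le_p.
exists (q, j); split; last by [].
  apply/IHn; split=> // i lt_i; have := le_p i (ltnW lt_i).
  by rewrite nth_rcons sz_q lt_i.
by have := le_p n (ltnSn n); rewrite nth_rcons sz_q ltnn eqxx mem_iota ltnS.
Qed.

Lemma parent_words_uniq n : uniq (parent_words n).
Proof.
elim: n => // n IHn; rewrite parent_words_recr.
apply: allpairs_uniq; rewrite ?iota_uniq //.
by case=> [p j] [q i] _ _ /= /rcons_inj[-> ->].
Qed.

(** Multiplicity in [p] is the degree in the tree; starting at 1 leaves out the root. *)
Definition even_letters (p : seq nat) : nat :=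
  count (fun v => ~~ odd (count_mem v p)) (iota 1 (size p)).

Lemma count_flip (T : eqType) (e : pred T) (j : T) (s : seq T) :
  uniq s -> j \in s ->
  count (fun v => e v (+) (j == v)) s + e j = count e s + ~~ e j.
Proof.
move=> us js; have /seq.permP perm_s := perm_to_rem js; rewrite !perm_s /= eqxx.
have -> : count (fun v => e v (+) (j == v)) (rem j s) = count e (rem j s).
  apply: eq_in_count => v; rewrite mem_rem_uniq // inE eq_sym => /andP[/negPf-> _].
  by rewrite addbF.
by case: (e j) => /=; lia.
Qed.

Lemma count_even_letters_rcons n p (a : pred nat) :
  p \in parent_words n ->
  count a [seq even_letters (rcons p j) | j <- iota 0 n.+1] =
  growth n (even_letters p) a.
Proof.
case/parent_wordsP=> sz_p le_p; pose e v := ~~ odd (count_mem v p).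
have even_rcons j : j <= n -> even_letters (rcons p j) =
    (count (fun v => e v (+) (j == v)) (iota 1 n)).+1.
  move=> le_j; rewrite /even_letters size_rcons sz_p iota_recr count_cat /=.
  (* The new vertex is a leaf, hence even; it accounts for the successor in [even_rcons]. *)
  have -> : count_mem n.+1 (rcons p j) = 0.
    apply/count_memPn/(nthP 0) => -[i]; rewrite size_rcons sz_p nth_rcons sz_p.
    rewrite ltnS leq_eqVlt => /orP[/eqP -> | lt_i].
      by rewrite ltnn eqxx; lia.
    by rewrite lt_i => eq_i; have := le_p i lt_i; rewrite eq_i; lia.
  rewrite addn0 addn1; congr _.+1; apply: eq_count => v.
  by rewrite -cats1 count_cat /= addn0 oddD oddb /e addNb.
have even_p : even_letters p = count e (iota 1 n) by rewrite /even_letters sz_p.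
have cntE : count e (iota 1 n) + count (predC e) (iota 1 n) = n.
  by rewrite count_predC size_iota.
(* The root 0 lies outside [iota 1 n], so attaching to it flips no counted parity. *)
have -> : [seq even_letters (rcons p j) | j <- iota 0 n.+1] =
    (even_letters p).+1 ::
      [seq if e j then even_letters p else (even_letters p).+2 | j <- iota 1 n].
  rewrite [iota 0 _]/= map_cons even_rcons // even_p; congr (_.+1 :: _).
    by apply: eq_in_count => -[|v]; rewrite mem_iota //= addbF.
  apply/eq_in_map => j; rewrite mem_iota add1n ltnS => /andP[j_gt0 le_j].
  rewrite even_rcons //.
  have := @count_flip _ e j (iota 1 n) (iota_uniq _ _); rewrite -even_p.
  by rewrite mem_iota add1n ltnS j_gt0 le_j => /(_ isT); case: (e j) => /=; lia.
(* Turns n - k into the number of odd nonroot vertices. *)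
rewrite /growth -even_p in cntE *; rewrite -{2}cntE addKn /= count_map.
have -> : count (preim (fun j => if e j then even_letters p else (even_letters p).+2) a)
      (iota 1 n) =
    count e (iota 1 n) * a (even_letters p) +
    count (predC e) (iota 1 n) * a (even_letters p).+2.
  elim: (iota 1 n) => //= j s ->; case: (e j) => /=; lia.
by rewrite -even_p addnCA addnA.
Qed.

Lemma count_even_letters n (a : pred nat) :
  count a [seq even_letters p | p <- parent_words n.+1] =
  \sum_(k <- [seq even_letters p | p <- parent_words n]) growth n k a.
Proof.
rewrite parent_words_recr map_flatten -map_comp count_flatten_map big_map.
by apply: eq_big_seq => p /count_even_letters_rcons <-; rewrite -map_comp.
Qed.

Lemma perm_turns_even_letters n :
  perm_eq [seq turns false 0 t | t <- permutations (iota 1 n)]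
          [seq even_letters p | p <- parent_words n].
Proof.
elim: n => // n IHn; apply/seq.permP=> a.
by rewrite count_turns_permutations count_even_letters (perm_big _ IHn).
Qed.

(** * Runs of a permutation as direction changes *)

Lemma card_ord_count m (P : pred nat) : #|[set i : 'I_m | P i]| = count P (iota 0 m).
Proof. by rewrite cardsE cardE /enum_mem size_filter -enumT -val_enum_ord count_map. Qed.

Definition ascent (w : seq nat) (i : nat) : bool := nth 0 w i < nth 0 w i.+1.

Definition turn_at (b : bool) (w : seq nat) (i : nat) : bool :=
  ascent w i != (if i is i'.+1 then ascent w i' else b).

Lemma turns_count b x t : turns b x t = count (turn_at b (x :: t)) (iota 0 (size t)).
Proof.
elim: t b x => //= y t IHt b x; rewrite IHt; congr (_ + _).
  by rewrite eq_sym.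
rewrite (iotaDl 1 0) count_map; apply: eq_count => -[|i] //=.
Qed.

(** Entries are distinct, so a step that is not an ascent is a descent, and monotone means that all
    steps agree in direction. *)
Lemma monotone_segmentP (w : seq nat) (i j : nat) :
  uniq w -> j < size w ->
  reflect (i <= j /\ forall k l, i <= k < j -> i <= l < j -> ascent w k = ascent w l)
          (monotone_segment w i j).
Proof.
move=> uw lt_j.
have size_seg : size (segment w i j) = j.+1 - i.
  by rewrite size_drop size_takel.
have nth_seg k : i + k <= j -> nth 0 (segment w i j) k = nth 0 w (i + k).
  by move=> le_k; rewrite nth_drop nth_take.
have sortedE (e : rel nat) : reflect
    (forall k, i <= k < j -> e (nth 0 w k) (nth 0 w k.+1)) (sorted e (segment w i j)).
  apply: (iffP (sortedP 0)) => [e_seg k /andP[le_k lt_k] | e_w k].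
    have kE : i + (k - i) = k by lia.
    have nth_k : nth 0 (segment w i j) (k - i) = nth 0 w k by rewrite nth_seg kE // ltnW.
    have nth_k1 : nth 0 (segment w i j) (k - i).+1 = nth 0 w k.+1.
      by rewrite nth_seg addnS kE.
    by have := e_seg (k - i); rewrite size_seg nth_k nth_k1; apply; lia.
  rewrite size_seg => lt_k; rewrite !nth_seg ?addnS; try lia.
  by apply: e_w; lia.
have descent k : k < j -> ~~ ascent w k -> nth 0 w k > nth 0 w k.+1.
  move=> lt_k; have /negPf neq_k : nth 0 w k.+1 != nth 0 w k.
    by rewrite nth_uniq ?(ltn_trans lt_k lt_j) ?(leq_ltn_trans lt_k lt_j) // gtn_eqF.
  by rewrite /ascent -leqNgt leq_eqVlt neq_k.
apply: (iffP andP) => -[le_ij mono]; split=> //.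
  move=> k l kP lP; case/orP: mono => /sortedE /= mono.
    by rewrite /ascent !mono.
  by rewrite /ascent !ltnNge (ltnW (mono k kP)) (ltnW (mono l lP)).
have [asc | nasc] := boolP (ascent w i); apply/orP; [left | right].
  by apply/sortedE => k kP; have : ascent w k by rewrite (mono k i) //; lia.
apply/sortedE => k kP; apply: descent; first by lia.
by rewrite (mono k i) //; lia.
Qed.

Lemma size_perm_word n (s : {perm 'I_n}) : size (perm_word s) = n.+1.
Proof. by rewrite /= size_map size_enum_ord. Qed.

Lemma uniq_perm_word n (s : {perm 'I_n}) : uniq (perm_word s).
Proof.
rewrite /=; apply/andP; split; first by apply/mapP => -[].
by rewrite map_inj_uniq ?enum_uniq // => i j [] /val_inj /perm_inj.
Qed.

(** By maximality a run is determined by its start, and the starts are exactly the positions below n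
    where the direction changes. *)
Lemma card_up_down_runs n (s : {perm 'I_n}) :
  0 < n -> #|up_down_runs s| = turns false 0 (behead (perm_word s)).
Proof.
move=> n_gt0; set w := perm_word s.
have uw : uniq w := uniq_perm_word s; have sw : size w = n.+1 := size_perm_word s.
have monoP (i j : nat) : j <= n ->
    reflect (i <= j /\ forall k l, i <= k < j -> i <= l < j -> ascent w k = ascent w l)
            (monotone_segment w i j).
  by move=> le_j; apply: monotone_segmentP; rewrite ?sw.
have mono_step (i : nat) : i < n -> monotone_segment w i i.+1.
  by move=> lt_i; apply/monoP => //; split=> // k l kP lP; congr ascent; lia.
(* With the initial direction [false], this makes position 0 a turn. *)
have ascent0 : ascent w 0.
  have : nth 0 w 1 != 0 by rewrite -[X in _ != X]/(nth 0 w 0) nth_uniq ?sw.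
  by rewrite -lt0n.
rewrite turns_count size_behead sw -card_ord_count.
have maximal (i j : 'I_n.+1) (k l : nat) : (i, j) \in up_down_runs s ->
    k <= i -> j <= l -> l <= n -> monotone_segment w k l -> k = i /\ l = j.
  rewrite inE => /andP[_ /forallP max_ij] le_k le_l le_n mono.
  have lt_k : k < n.+1 by apply: leq_ltn_trans le_k (ltn_ord i).
  have := max_ij (Ordinal lt_k, Ordinal (le_n : l < n.+1)).
  by rewrite /= le_k le_l mono => /eqP[<- <-].
pose starts := [set i : 'I_n.+1 | (i < n) && turn_at false w i].
have -> : #|[set i : 'I_n | turn_at false w i]| = #|starts|.
  have widen_inj : injective (@widen_ord n n.+1 (leqnSn n)).
    by move=> i j /(congr1 val) /= /val_inj.
  rewrite -(card_imset _ widen_inj); congr #|pred_of_set _|.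
  apply/setP=> i; rewrite inE; apply/imsetP/andP=> [[k] | [lt_i turn_i]].
    by rewrite inE => turn_k ->; split=> /=.
  by exists (Ordinal lt_i); [rewrite inE | apply: val_inj].
have le_ord (i : 'I_n.+1) : i <= n by rewrite -ltnS.
have runP (i j : 'I_n.+1) : (i, j) \in up_down_runs s -> monotone_segment w i j.
  by rewrite inE => /andP[].
have run_inj : {in up_down_runs s &, injective fst}.
  move=> [i j] [i' j'] ij_run; rewrite /= => + eq_i; rewrite -{}eq_i => ij'_run.
  congr pair; apply/val_inj => /=; case: (leqP j j') => [le_j | /ltnW le_j].
    by have [] := maximal i j i j' ij_run (leqnn i) le_j (le_ord _) (runP _ _ ij'_run).
  by have [] := maximal i j' i j ij'_run (leqnn i) le_j (le_ord _) (runP _ _ ij_run).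
rewrite -(card_in_imset run_inj); congr #|pred_of_set _|.
apply/setP=> i; apply/imsetP/idP => [[[{}i j] run_ij ->] | ].
  have mono_ij := runP i j run_ij; rewrite inE /=.
  have le_j := le_ord j; have le_i := le_ord i.
  have /(monoP _ _ le_j)[le_ij asc_ij] := mono_ij.
  (* A run starting at n would be a single entry, properly inside the last step. *)
  have lt_i : i < n.
    rewrite ltnNge; apply/negP=> ge_i.
    have mono_n := mono_step n.-1; rewrite prednK // leqnn in mono_n.
    by have [] := maximal i j n.-1 n run_ij _ _ _ (mono_n isT); lia.
  rewrite lt_i /turn_at; case def_i: (i : nat) => [|i']; first by rewrite ascent0.
  apply/negP=> /eqP asc_eq.
  have lt_ij : i < j.
    rewrite ltn_neqAle le_ij andbT; apply/eqP=> eq_ij.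
    by have [] := maximal i j i i.+1 run_ij _ _ _ (mono_step _ lt_i); lia.
  (* Without a turn at i the run could be extended one entry to the left. *)
  have [] // := maximal i j i' j run_ij; try lia.
  apply/(monoP _ _ le_j); split; first by lia.
  have asc_l l : i' <= l < j -> ascent w l = ascent w i.
    case/andP; rewrite leq_eqVlt => /orP[/eqP <- _ | lt_l lt_l2].
      by rewrite -asc_eq def_i.
    by apply: asc_ij; lia.
  by move=> k l kP lP; rewrite !asc_l.
rewrite inE => /andP[lt_i turn_i].
have mono_i := mono_step i lt_i.
(* The run starting at a turn i is the longest monotone segment from i. *)
case: (@arg_maxnP _ (Ordinal (lt_i : i.+1 < n.+1))
         (fun j : 'I_n.+1 => monotone_segment w i j) (fun j => j)) => // j mono_ij max_j.
exists (i, j) => //; rewrite inE /= mono_ij; apply/forallP=> -[k l]; apply/implyP => /=.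
case/and3P=> le_k le_l mono_kl.
have lt_ij : i < j := max_j (Ordinal (lt_i : i.+1 < n.+1)) mono_i.
have /(monoP _ _ (le_ord l))[_ asc_kl] := mono_kl.
have eq_k : k = i.
  apply/val_inj/eqP; rewrite /= eqn_leq le_k leqNgt; apply/negP => lt_k.
  move: turn_i; rewrite /turn_at; case def_i: (i : nat) => [|i']; first by lia.
  by rewrite -def_i (asc_kl i i') ?eqxx //; lia.
rewrite eq_k in mono_kl *; apply/eqP; congr pair.
by apply/val_inj/eqP; rewrite eqn_leq le_l andbT; apply: max_j.
Qed.

Lemma perm_words n :
  perm_eq [seq behead (perm_word s) | s : {perm 'I_n}] (permutations (iota 1 n)).
Proof.
set L := [seq _ | _ : _].
have uL : uniq L.
  rewrite map_inj_uniq ?enum_uniq // => s t; rewrite /= => /eq_in_map eq_st.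
  by apply/permP=> i; have [/val_inj] := eq_st i (mem_enum _ _).
have subL : {subset L <= permutations (iota 1 n)}.
  move=> _ /mapP[s _ ->]; rewrite mem_permutations; apply: uniq_perm.
  - by have /andP[] := uniq_perm_word s.
  - exact: iota_uniq.
  move=> x; rewrite mem_iota add1n ltnS; apply/mapP/andP=> [[i _ ->] // | ].
  case: x => [[] // | x [_ lt_x]]; exists ((s^-1)%g (Ordinal lt_x)).
    exact: mem_enum.
  by rewrite permKV.
apply: uniq_perm => //; first exact: permutations_uniq.
apply: (uniq_min_size uL subL _).2.
by rewrite size_permutations ?iota_uniq // size_iota size_map -cardE card_Sn.
Qed.

(** * Increasing trees as parent words *)

(** The guard excludes the root, for which [.-1] would read the parent of vertex 1. *)
Definition parent_edges (n : nat) (p : seq nat) : {set 'I_n.+1 * 'I_n.+1} :=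
  [set e : 'I_n.+1 * 'I_n.+1 | (0 < e.2) && (nth 0 p e.2.-1 == e.1)].

Lemma child_parent_edges n p (u v : 'I_n.+1) :
  child (parent_edges n p) u v = (0 < v) && (nth 0 p v.-1 == u).
Proof. by rewrite /child inE. Qed.

Lemma increasing_treeP n (E : {set 'I_n.+1 * 'I_n.+1}) :
  reflect (exists2 p, p \in parent_words n & E = parent_edges n p)
          (is_increasing_tree E).
Proof.
apply: (iffP andP) => [[/and3P[/eqP par0 /forallP par1 _] /forallP incr] | [p]].
  (* The default is never taken at a nonroot vertex, which has exactly one parent. *)
  pose f v := odflt ord0 [pick u in parents E v].
  have fP (v u : 'I_n.+1) : v != ord0 -> child E u v = (u == f v).
    move=> v_n0; have /implyP/(_ v_n0)/cards1P[x xE] := par1 v.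
    have childE y : child E y v = (y == x) by have /setP/(_ y) := xE; rewrite !inE.
    rewrite childE /f; case: pickP => [y | /(_ x)]; rewrite inE childE ?eqxx //.
    by move=> /eqP->.
  exists [seq nat_of_ord (f (inord i)) | i <- iota 1 n].
    apply/parent_wordsP; split=> [|i lt_i]; first by rewrite size_map size_iota.
    rewrite (nth_map 0) ?size_iota // nth_iota // add1n -ltnS.
    have i_n0 : inord i.+1 != ord0 :> 'I_n.+1 by rewrite -val_eqE /= inordK.
    have /forallP/(_ (inord i.+1))/implyP := incr (f (inord i.+1)).
    by rewrite fP // eqxx inordK //; apply.
  apply/setP=> -[u v]; rewrite inE /= -/(child E u v).
  have [-> | v_n0] := eqVneq v ord0.
    by have /setP/(_ u) := par0; rewrite !inE.
  have v_gt0 : 0 < v by rewrite lt0n.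
  have lt_v : v.-1 < n by rewrite -ltnS prednK.
  rewrite fP // v_gt0 (nth_map 0) ?size_iota // nth_iota // add1n prednK //.
  by rewrite inord_val eq_sym.
case/parent_wordsP=> sz_p le_p ->.
have lt_p (v : 'I_n.+1) : 0 < v -> nth 0 p v.-1 < v.
  move=> v_gt0; rewrite -[X in _ < X](prednK v_gt0) ltnS; apply: le_p.
  by rewrite -ltnS prednK.
have par_lt (v : 'I_n.+1) : 0 < v -> nth 0 p v.-1 < n.+1.
  by move=> v_gt0; apply: ltn_trans (lt_p v v_gt0) (ltn_ord v).
split; last first.
  apply/forallP=> u; apply/forallP=> v; apply/implyP.
  by rewrite child_parent_edges => /andP[/lt_p lt_v /eqP <-].
apply/and3P; split.
- by apply/eqP/setP=> u; rewrite !inE child_parent_edges.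
- apply/forallP=> v; apply/implyP; rewrite -val_eqE -lt0n => v_gt0.
  apply/cards1P; exists (Ordinal (par_lt v v_gt0)); apply/setP=> u.
  by rewrite !inE child_parent_edges v_gt0 -val_eqE eq_sym.
(* Parents are smaller, so induction on a bound for v reaches the root. *)
apply/forallP=> v; have [m] := ubnP (v : nat); elim: m v => // m IHm v le_v.
have [-> | v_n0] := eqVneq v ord0; first exact: connect0.
have v_gt0 : 0 < v by rewrite lt0n.
apply: connect_trans (IHm (Ordinal (par_lt v v_gt0)) _) _.
  exact: leq_trans (lt_p v v_gt0) le_v.
by apply: connect1; rewrite child_parent_edges v_gt0 /=.
Qed.

(** The letter at index i is read back from the only edge into vertex i+1. *)
Lemma parent_edges_inj n : {in parent_words n &, injective (parent_edges n)}.
Proof.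
move=> p q /parent_wordsP[sz_p le_p] /parent_wordsP[sz_q le_q] eq_pq.
apply: (@eq_from_nth _ 0) => [|i]; rewrite sz_p // => lt_i.
have lt_pi : nth 0 p i < n.+1 by apply: leq_ltn_trans (le_p i lt_i) (ltnW _).
have /setP/(_ (Ordinal lt_pi, Ordinal (lt_i : i.+1 < n.+1))) := eq_pq.
by rewrite !inE /= eqxx => /esym/eqP.
Qed.

Lemma degree_parent_edges n p (u : 'I_n.+1) :
  size p = n -> degree (parent_edges n p) u = count_mem (u : nat) p.
Proof.
move=> sz_p; rewrite /degree /children.
have -> : [set v | child (parent_edges n p) u v] =
    [set v : 'I_n.+1 | (0 < v) && (nth 0 p v.-1 == u)].
  by apply/setP=> v; rewrite !inE child_parent_edges.
rewrite (card_ord_count _ (fun v => (0 < v) && (nth 0 p v.-1 == u))) /= add0n.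
rewrite (iotaDl 1 0) count_map -[p in RHS](mkseq_nth 0) /mkseq count_map sz_p.
by apply: eq_count.
Qed.

Lemma card_even_nonroot n p :
  size p = n -> #|even_nonroot ord0 (parent_edges n p)| = even_letters p.
Proof.
move=> sz_p.
have -> : even_nonroot ord0 (parent_edges n p) =
    [set v : 'I_n.+1 | (0 < v) && ~~ odd (count_mem (v : nat) p)].
  by apply/setP=> v; rewrite !inE degree_parent_edges // -val_eqE lt0n.
rewrite (card_ord_count _ (fun v => (0 < v) && ~~ odd (count_mem v p))) /= add0n.
rewrite /even_letters sz_p; apply: eq_in_count => v.
by rewrite mem_iota => /andP[v_gt0 _]; rewrite v_gt0.
Qed.

Lemma tree_words n :
  perm_eq [seq val T | T : {E : {set 'I_n.+1 * 'I_n.+1} | is_increasing_tree E}]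
          [seq parent_edges n p | p <- parent_words n].
Proof.
apply: uniq_perm.
- by rewrite map_inj_uniq ?enum_uniq //; apply: val_inj.
- by rewrite map_inj_in_uniq ?parent_words_uniq //; apply: parent_edges_inj.
move=> E; apply/mapP/mapP => [[T _ ->] | [p pP EE]].
  by have /increasing_treeP := valP T.
have treeE : is_increasing_tree E by apply/increasing_treeP; exists p.
by exists (Sub E treeE); [exact: mem_enum | rewrite SubK].
Qed.

Theorem theorem5p1 (n : nat) (hn : 1 <= n) :
  exists phi : {perm 'I_n} -> increasing_tree n,
    bijective phi /\
    (forall sigma : {perm 'I_n},
       #|up_down_runs sigma| = #|even_nonroot ord0 (val (phi sigma))|).
Proof.
apply: (@perm_eq_bijection {perm 'I_n}
  {E : {set 'I_n.+1 * 'I_n.+1} | is_increasing_tree E}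
  (fun s => #|up_down_runs s|) (fun T => #|even_nonroot ord0 (val T)|)).
have -> : [seq #|up_down_runs s| | s <- enum {perm 'I_n}] =
    [seq turns false 0 t | t <- [seq behead (perm_word s) | s : {perm 'I_n}]].
  by rewrite -[RHS]map_comp; apply: eq_map => s; rewrite card_up_down_runs.
apply: perm_trans (seq.perm_map _ (perm_words n)) _.
apply: perm_trans (perm_turns_even_letters n) _.
have -> : [seq even_letters p | p <- parent_words n] =
    [seq #|even_nonroot ord0 E| | E <- [seq parent_edges n p | p <- parent_words n]].
  rewrite -[RHS]map_comp; apply/eq_in_map=> p /parent_wordsP[sz_p _].
  by rewrite /= card_even_nonroot.
have := seq.perm_map (fun E => #|even_nonroot ord0 E|) (tree_words n).
by rewrite perm_sym -[X in perm_eq _ X]map_comp.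
Qed.
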